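(* Let $\varphi^{(1)},\varphi^{(2)},\varphi^{(3)},\dots$ be independent commuting variables, put $\varphi^{(-1)}=1$, $\varphi^{(0)}=0$, and let $$\varphi(\lambda)=\frac1\lambda+\sum_{k\ge1}\varphi^{(k)}\lambda^k,\qquad \varphi_\lambda=\frac{d\varphi}{d\lambda}=-\frac1{\lambda^2}+\sum_{k\ge1}k\varphi^{(k)}\lambda^{k-1}.$$ For $n\in\mathbb Z$ let $f_n=\mathfrak P_\varphi(\lambda^n\varphi_\lambda)$ (notation in the context), and let $S^{(n)}=\partial_{f_{1-n}}$. Then for all $n,m\in\mathbb Z$, $$[S^{(n)},S^{(m)}]=(m-n)\,S^{(n+m)},$$ i.e. the $S^{(n)}$, $n\in\mathbb Z$, span a Lie algebra with the commutation relations of the Witt algebra.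
   Context: All series have coefficients in the polynomial ring $R=\mathbb R[\varphi^{(1)},\varphi^{(2)},\dots]$. Let $w(\lambda)=1/\varphi(\lambda)=\lambda+O(\lambda^3)$, a power series in $\lambda$ without constant term. Every formal Laurent series $F$ in $\lambda$ with finitely many negative powers and coefficients in $R$ can be written uniquely as $F=\sum_{k\le m}c_k\,\varphi(\lambda)^k$ with $c_k\in R$ independent of $\lambda$ (i.e. as a Laurent series in $w$); write $[\varphi^k]F=c_k$, $P_\varphi F=\sum_{k=0}^{m}c_k\varphi(\lambda)^k$ and $\mathfrak P_\varphi F=F-P_\varphi F$. Then $\mathfrak P_\varphi F$ is a power series in $\lambda$ with no constant term (lowest order $\ge1$); in particular $f_n=\lambda^n\varphi_\lambda$ for $n\ge3$. For a formal series $f=\sum_{i\ge1}f^{(i)}\lambda^i$ with $f^{(i)}\in R$, $\partial_f$ denotes the derivation $\sum_{i\ge1}f^{(i)}\,\partial/\partial\varphi^{(i)}$ of $R$ (it acts on series coefficientwise). (In the paper, $\varphi^{(1)}=-y$, $\varphi^{(2)}=-x$, $\varphi^{(3)}=-z-y^2/2$ and $\varphi^{(k)}$, $k\ge4$, are nonlocal variables of a covering of the Gibbons–Tsarev equation, and the $S^{(n)}$ are the corresponding nonlocal symmetries written in these coordinates.) *)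

(* Defs.v *)
From Stdlib Require Import Reals ClassicalEpsilon.
From HB Require Import structures.
From mathcomp Require Import all_boot all_order all_algebra.
From mathcomp Require Import finmap monalg.
From mathcomp Require Import Rstruct.

Set Implicit Arguments.
Unset Strict Implicit.
Unset Printing Implicit Defensive.

Import Order.TTheory GRing.Theory Num.Theory.
Local Open Scope ring_scope.

(* The coefficient ring  RP = R[phi^(1), phi^(2), ...].                *)
(* Polynomials over the reals in commuting variables indexed by nat:   *)
(* the variable with index i (the monomial  ucm i) stands for          *)
(* phi^(i+1).                                                          *)
Definition RP := {malg R[cmonom nat]}.

(* phi^(k) for k : int, with the conventions phi^(-1) = 1, phi^(0) = 0;
   (phi^(k) = 0 for k <= -2, i.e. phi(lambda) = sum_{k >= -1} phi^(k) lambda^k). *)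
Definition phic (k : int) : RP :=
  match k with
  | Posz 0 => 0
  | Posz n.+1 => << ucm n >>
  | Negz 0 => 1
  | Negz _ => 0
  end.

(* Formal power series in lambda with coefficients in RP: nat -> RP.   *)
Definition ps1 : nat -> RP := fun n => (n == 0)%:R.
Definition psmul (a b : nat -> RP) : nat -> RP :=
  fun n => \sum_(i < n.+1) a i * b (n - i)%N.
Definition pspow (a : nat -> RP) (k : nat) : nat -> RP := iter k (psmul a) ps1.
(* multiplicative inverse of a power series with constant term 1:
   a^{-1} = sum_j (1 - a)^j, the coefficient of lambda^n only receiving
   contributions from j <= n. *)
Definition psinv (a : nat -> RP) : nat -> RP :=
  fun n => \sum_(j < n.+1) pspow (fun i => ps1 i - a i) j n.

(* u(lambda) = lambda * phi(lambda) = 1 + sum_{k>=1} phi^(k) lambda^(k+1) *)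
Definition useries : nat -> RP := fun n => phic (n%:Z - 1).

Definition upow (k : int) : nat -> RP :=
  match k with
  | Posz n => pspow useries n
  | Negz n => pspow (psinv useries) n.+1
  end.

(* Formal Laurent series in lambda with coefficients in RP: int -> RP  *)
(* (the coefficient of lambda^j).                                      *)

(* phi(lambda)^k = lambda^(-k) u(lambda)^k, k : int *)
Definition phipow (k : int) : int -> RP :=
  fun j => match j + k with Posz n => upow k n | Negz _ => 0 end.

(* lambda^n * phi_lambda,  phi_lambda = sum_{k >= -1} k phi^(k) lambda^(k-1) *)
Definition lamphi (n : int) : int -> RP :=
  fun j => (j - n + 1)%:~R * phic (j - n + 1).

Definition nat_of_int (z : int) : nat := match z with Posz n => n | Negz _ => 0%N end.

(* F = sum_{k <= m} c_k phi(lambda)^k, coefficientwise: the coefficient of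
   lambda^j of phi^k vanishes for k < -j, so the coefficient of lambda^j of
   the right-hand side is the finite sum over -j <= k <= m. *)
Definition phi_expansion (F : int -> RP) (m : int) (c : int -> RP) : Prop :=
  forall j : int,
    F j = \sum_(t < nat_of_int (m + j + 1)) c (t%:Z - j) * phipow (t%:Z - j) j.

Definition phi_exp (F : int -> RP) : int * (int -> RP) :=
  epsilon (inhabits ((0 : int), fun _ => (0 : RP)))
          (fun p => phi_expansion F p.1 p.2).

Definition Pphi (F : int -> RP) : int -> RP :=
  fun j => \sum_(t < nat_of_int ((phi_exp F).1 + 1)) (phi_exp F).2 t%:Z * phipow t%:Z j.

Definition fPphi (F : int -> RP) : int -> RP := fun j => F j - Pphi F j.

Definition fser (n : int) : int -> RP := fPphi (lamphi n).

(* The derivation  d_f = sum_{i >= 1} f^(i) d/d phi^(i)  of RP, where   *)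
(* f^(i) is the coefficient of lambda^i of f.  On a monomial k it is    *)
(* sum over the variables i in k of (k i) * f^(i+1) * k / x_i.          *)
Definition der_mon (f : int -> RP) (k : cmonom nat) : RP :=
  \sum_(i <- finsupp k) (k i)%:R * f (i.+1)%:Z * << divcm k (ucm i) >>.

Definition der (f : int -> RP) (p : RP) : RP :=
  \sum_(k <- msupp p) p@_k *: der_mon f k.

Definition S (n : int) : RP -> RP := der (fser (1 - n)).

(* Main.v *)
Require Import Defs.
From Stdlib Require Import Reals ClassicalEpsilon.
From HB Require Import structures.
From mathcomp Require Import all_boot all_order all_algebra.
From mathcomp Require Import finmap monalg.
From mathcomp Require Import Rstruct.
From mathcomp Require Import zify ring.
Set Implicit Arguments.
Unset Strict Implicit.
Unset Printing Implicit Defensive.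
Import Order.TTheory GRing.Theory Num.Theory.
Local Open Scope ring_scope.

(** A derivation of the coefficient ring is determined by its action on the
    generators, so it suffices to compare both sides on [phi].  Put [a = 1 - n],
    [b = 1 - m] and write [f_a = lambda^a phi_lambda - p_a(phi)], with [p_a] a
    polynomial over the coefficient ring.  In [d_(f_a) f_b - d_(f_b) f_a] the mixed
    terms [lambda^b p_a'(phi) phi_lambda + lambda^a p_b'(phi) phi_lambda] are symmetric
    in [a] and [b] and cancel, and there remains [(a - b) lambda^(a+b-1) phi_lambda] plus
    a polynomial in [phi].  As the bracket has only positive powers of [lambda], and a
    nonzero polynomial in [phi] does not, the bracket is [(a - b) f_(a+b-1)]. *)

(** * Derivations of a monoid algebra *)

Lemma scaler_leibniz (A : comNzRingType) (B : algType A) (a b : A) (x y u v : B) :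
  (a * b) *: (x * v + u * y) = a *: x * (b *: v) + a *: u * (b *: y).
Proof. by rewrite -!scalerAl -!scalerAr !scalerA scalerDr. Qed.

Section MonoidAlgebraDerivation.
Variables (A : comNzRingType) (K : conomType) (d : K -> {malg A[K]}).
Implicit Types (p q : {malg A[K]}) (k l : K).

Lemma monalgZ1 c k : << c *g k >> = c *: << k >> :> {malg A[K]}.
Proof. by apply/malgP => l; rewrite mcoeffZ !mcoeffU mulrnAr mulr1. Qed.

Lemma monalgM k l : << k >> * << l >> = << mmul k l >> :> {malg A[K]}.
Proof. by rewrite malgM_def fgmulUU mulr1. Qed.

Definition malgder p : {malg A[K]} := \sum_(k <- msupp p) p@_k *: d k.

(** The support varies with [p], so additivity is not visible on the sum; [mmap] is already known to
    be additive. *)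
Lemma malgder_mmap : malgder =1 mmap (@malgC K A) d.
Proof. by move=> p; rewrite mmapE; apply: eq_bigr => k _; rewrite mul_malgC. Qed.

Lemma malgderB : {morph malgder : p q / p - q}.
Proof. by move=> p q; rewrite !malgder_mmap raddfB. Qed.

HB.instance Definition _ := GRing.isZmodMorphism.Build _ _ malgder malgderB.

Lemma malgder_monom c k : malgder << c *g k >> = c *: d k.
Proof. by rewrite malgder_mmap mmapU mul_malgC. Qed.

Hypothesis dM : forall k l, d (mmul k l) = d k * << l >> + << k >> * d l.

Lemma malgderM p q : malgder (p * q) = malgder p * q + p * malgder q.
Proof.
have malgderE r : malgder r = \sum_(k <- msupp r) r@_k *: d k by [].
rewrite malgME raddf_sum (malgderE p) (malgderE q).
rewrite [X in _ = _ * X + _](monalgE q) [X in _ = _ + X * _](monalgE p).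
rewrite !big_distrlr -big_split; apply: eq_bigr => k _ /=.
rewrite raddf_sum -big_split; apply: eq_bigr => l _ /=.
rewrite malgder_monom dM (monalgZ1 _ k) (monalgZ1 _ l).
exact: scaler_leibniz.
Qed.

(** By the Leibniz rule [D] kills every product of generators, and additivity extends this to all
    elements. Applied to the difference of two derivations, it reduces their equality to the
    generators. *)
Lemma derivation_generators_eq0 (T : Type) (g : T -> K)
    (D : {additive {malg A[K]} -> {malg A[K]}}) :
  (forall P : K -> Prop, P mone -> (forall t k, P k -> P (mmul (g t) k)) -> forall k, P k) ->
  (forall p q, D (p * q) = D p * q + p * D q) ->
  (forall c, D c%:MP = 0) -> (forall t, D << g t >> = 0) -> forall p, D p = 0.
Proof.
move=> gind DM DC Dg.
have Dmon k : D << k >> = 0.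
  elim/gind: k => [|t k Dk]; first exact: (DC 1).
  by rewrite -monalgM DM Dg Dk mul0r mulr0 addr0.
move=> p; rewrite (monalgE p) raddf_sum big1 // => k _.
by rewrite monalgZ1 -mul_malgC DM DC Dmon mul0r mulr0 addr0.
Qed.

End MonoidAlgebraDerivation.

(** * Monomials and derivations of a polynomial ring *)

Lemma cmonom_factor (I : choiceType) (k : cmonom I) : k != mone -> exists i, exists l, k = mmul (ucm i) l.
Proof.
move=> k1; have [i ki] : exists i, k i != 0%N.
  have [|[i ik]] := fset_0Vmem (finsupp k); last by exists i; rewrite -mem_finsupp.
  move=> k0; case/eqP: k1; apply/eqP/cmP => i; rewrite cm1.
  by apply/fsfun_dflt; rewrite k0.
exists i, (divcm k (ucm i)); apply/eqP/cmP => j; rewrite mulcmE divcmE ucmE.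
by case: eqP => [<-|]; lia.
Qed.

Lemma cmonom_gen_ind (I : choiceType) (P : cmonom I -> Prop) :
  P mone -> (forall i k, P k -> P (mmul (ucm i) k)) -> forall k, P k.
Proof.
move=> P1 PM k; have [n] := ubnP (mdeg k); elim: n k => // n IH k.
have [-> //|/cmonom_factor[i [l ->]]] := eqVneq k mone.
by rewrite mdegM mdegU add1n ltnS => /IH; apply: PM.
Qed.

(** Division of a monomial by a variable truncates exponents, so it is compatible with products only
    where the exponent is nonzero; elsewhere the factor [m] or [n] removes the term. *)
Lemma natrD_leibniz (B : comNzRingType) (m n : nat) (f a b c u v : B) :
  (m != 0%N -> c = a * v) -> (n != 0%N -> c = b * u) ->
  (m + n)%:R * f * c = m%:R * f * a * v + u * (n%:R * f * b).
Proof.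
move=> mc nc; transitivity (f * (m%:R * c) + f * (n%:R * c)); first by rewrite natrD; ring.
have -> : m%:R * c = m%:R * (a * v).
  by have [->|/mc ->] := eqVneq m 0%N; rewrite // mulr0n !mul0r.
have -> : n%:R * c = n%:R * (b * u).
  by have [->|/nc ->] := eqVneq n 0%N; rewrite // mulr0n !mul0r.
ring.
Qed.

Section PolynomialDerivation.
Variables (A : comNzRingType) (I : choiceType).
Implicit Types (k l : cmonom I).

Local Notation MA := (malg (monalg_cmonom__canonical__choice_Choice I) A).
(* Unfolding these makes unification over [{malg A[cmonom I]}] diverge. *)
Local Opaque fgmul fgzero fgone fgadd fgopp fgscale mkmalgU mcoeff ucm divcm mulcm onecm.

Variable f : I -> MA.

Definition monder k : MA :=
  \sum_(i <- finsupp k) (k i)%:R * f i * << divcm k (ucm i) >>.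

Lemma monderE k (d : {fset I}) : (finsupp k `<=` d)%fset ->
  monder k = \sum_(i <- d) (k i)%:R * f i * << divcm k (ucm i) >>.
Proof.
move=> kd; apply: big_fset_incl => // i _ /fsfun_dflt ->.
by rewrite !mul0r.
Qed.

Lemma divcmD k l i : k i != 0%N ->
  divcm (mulcm k l) (ucm i) = mulcm (divcm k (ucm i)) l.
Proof.
move=> ki; apply/eqP/cmP => j; rewrite !(divcmE, mulcmE) ucmE.
by case: eqP => [<-|]; lia.
Qed.

Lemma monderM k l :
  monder (mmul k l) = monder k * << l >> + << k >> * monder l.
Proof.
rewrite -[mmul k l]/(mulcm k l).
(* A common index set for all three sums; terms outside a support have exponent zero. *)
pose d := (finsupp k `|` finsupp l `|` finsupp (mulcm k l))%fset.
have kd : (finsupp k `<=` d)%fset by rewrite /d -fsetUA fsubsetUl.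
have ld : (finsupp l `<=` d)%fset by rewrite /d fsetUAC fsubsetUr.
rewrite (monderE kd) (monderE ld) (@monderE _ d) ?fsubsetUr //.
rewrite mulr_suml mulr_sumr -big_split; apply: eq_bigr => i _ /=.
rewrite mulcmE; apply: natrD_leibniz => ki; rewrite monalgM; last rewrite mulcmC.
- by rewrite divcmD.
- by rewrite divcmD.
Qed.

Lemma monder1 : monder mone = 0.
Proof. by rewrite /monder mdom1 big_seq_fset0. Qed.

Lemma monder_var i : monder (ucm i) = f i.
Proof.
rewrite (@monderE _ [fset i]%fset); last first.
  by apply/fsubsetP => j; rewrite in_fset1 mem_finsupp ucmE eqb0 negbK eq_sym.
rewrite big_seq_fset1 ucmE eqxx mul1r.
suff -> : divcm (ucm i) (ucm i) = mone by rewrite -[X in _ * X]/(1%:MP) mpolyC1E mulr1.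
by apply/eqP/cmP => j; rewrite divcmE subnn cm1.
Qed.

End PolynomialDerivation.

(** * Finite windows for sums over the integers *)

Lemma big_seq_support (A : nmodType) (T : eqType) (r r' : seq T) (h : T -> A) :
  uniq r -> uniq r' -> (forall i, h i != 0 -> (i \in r) && (i \in r')) ->
  \sum_(i <- r) h i = \sum_(i <- r') h i.
Proof.
move=> ur ur' hr.
have restr s : \sum_(i <- s) h i = \sum_(i <- [seq i <- s | h i != 0]) h i.
  rewrite big_filter [RHS]big_mkcond; apply: eq_bigr => i _.
  by case: eqP => // ->.
rewrite restr [RHS]restr; apply: perm_big; apply: uniq_perm; rewrite ?filter_uniq // => i.
rewrite !mem_filter; case h0: (h i != 0) => //=.
by have /andP[-> ->] := hr i h0.
Qed.

(** A finite stand-in for the sum over all integers in a Cauchy product of Laurent series, once [B]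
    bounds the support. *)
Definition window (B : nat) : seq int := [seq t%:Z - B%:Z | t <- iota 0 (2 * B).+1].

Lemma window_uniq B : uniq (window B).
Proof. by rewrite map_inj_uniq ?iota_uniq // => x y; lia. Qed.

Lemma mem_window B i : (i \in window B) = (- B%:Z <= i <= B%:Z).
Proof.
apply/mapP/idP => [[t]|iB]; first by rewrite mem_iota; lia.
by exists (absz (i + B%:Z)); [rewrite mem_iota|]; lia.
Qed.

(** * Powers of [phi], polynomials in [phi], and the bracket *)

Section LaurentPowers.
Variables (A : comNzRingType) (phi : int -> A) (V : nat -> int -> A).
Implicit Types (i j a b : int) (s t N B : nat).

Hypothesis V0 : forall j, V 0 j = (j == 0)%:R.
Hypothesis V1 : forall j, V 1 j = phi j.
Hypothesis V_small : forall t j, j < - t%:Z -> V t j = 0.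
Hypothesis V_top : forall t, V t (- t%:Z) = 1.
(** [V t j] is the coefficient of [lambda^j] in [phi^t]. A nonzero term has [- s <= i <= j + t],
    which the two bounds place inside the window. *)
Hypothesis VM : forall s t j B, (s <= B)%N -> j + t%:Z <= B%:Z ->
  \sum_(i <- window B) V s i * V t (j - i) = V (s + t) j.

Definition is_derivation (D : A -> A) := forall x y, D (x * y) = D x * y + x * D y.

Lemma derivation1 D : is_derivation D -> D 1 = 0.
Proof.
by move=> DM; apply: (addrI (D 1)); rewrite addr0 -[in RHS](mulr1 1) DM mulr1 mul1r.
Qed.

Lemma derivation_int (D : {additive A -> A}) m x :
  is_derivation D -> D (m%:~R * x) = m%:~R * D x.
Proof. by move=> DM; rewrite DM raddfMz derivation1 // mul0rz mul0r add0r. Qed.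

Definition phi_poly N (c : nat -> A) j := \sum_(s < N) c s * V s j.

Definition lam_dphi a j := (j - a + 1)%:~R * phi (j - a + 1).

(** Substituting [i - a + 1] shifts the window; the sums still agree because [B] is large enough for
    both ranges to contain the support. *)
Lemma dphi_convolution t j B a : 
  (absz j + absz a + t + 2 <= B)%N ->
  \sum_(i <- window B) lam_dphi a i * V t (j - i) =
  \sum_(i <- window B) i%:~R * phi i * V t (j - a + 1 - i).
Proof.
move=> hB; rewrite [RHS](@big_seq_support _ _ _ [seq i - a + 1 | i <- window B]).
- rewrite [RHS]big_map; apply: eq_bigr => i _; rewrite /lam_dphi.
  by congr (_ * V _ _); lia.
- exact: window_uniq.
- by rewrite map_inj_uniq ?window_uniq // => x y; lia.
move=> i hi; have [i1 i2] : -1 <= i /\ i <= j - a + 1 + t%:Z.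
  split; rewrite leNgt; apply: contraNN hi => hi; apply/eqP.
    by rewrite -V1 V_small ?mulr0 ?mul0r //; lia.
  by rewrite V_small ?mulr0 //; lia.
rewrite mem_window; apply/andP; split; first by lia.
apply/mapP; exists (i + a - 1); last by lia.
by rewrite mem_window; lia.
Qed.

(* The chain rule: [D phi = lambda^a phi_lambda - p(phi)] implies
   [D (phi^t) = lambda^a (phi^t)_lambda - t phi^(t-1) p(phi)]. *)
Lemma derivation_power (D : {additive A -> A}) a N c : is_derivation D ->
  (forall j, D (phi j) = lam_dphi a j - phi_poly N c j) ->
  forall t j, D (V t j) = (j - a + 1)%:~R * V t (j - a + 1)
     - t%:R * \sum_(s < N) c s * V (t + s).-1 j.
Proof.
move=> DM Dphi; elim=> [|t IH] j.
  rewrite !V0 mul0r subr0 raddfMn derivation1 // mul0rn.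
  by case: eqP => [->|_]; rewrite ?mulr0 ?mul0r.
(* Large enough for every convolution below, including those with [V s] for [s < N]. *)
pose B := (absz j + absz a + t + N + 3)%N.
have sum_phi s j' : j' + s%:Z <= B%:Z ->
  \sum_(i <- window B) phi i * V s (j' - i) = V s.+1 j'.
  move=> hj'; rewrite -add1n -(@VM _ _ _ B) ?addn_gt0 ?orbT //.
  by apply: eq_bigr => i _; rewrite V1.
rewrite -(sum_phi t j); last by rewrite /B; lia.
rewrite raddf_sum.
(* Leibniz rule for [phi * phi^t]: the first two sums come from [D phi], the last two from
   [D (phi^t)] by induction. *)
transitivity (\sum_(i <- window B) lam_dphi a i * V t (j - i)
  - \sum_(s < N) c s * \sum_(i <- window B) V s i * V t (j - i)
  + (\sum_(i <- window B) (j - a + 1 - i)%:~R * phi i * V t (j - a + 1 - i)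
  - t%:R * \sum_(s < N) c s * \sum_(i <- window B) phi i * V (t + s).-1 (j - i))).
  under [X in _ = _ - X + _]eq_bigr do rewrite mulr_sumr.
  under [X in _ = _ + (_ - _ * X)]eq_bigr do rewrite mulr_sumr.
  rewrite [X in _ = _ - X + _]exchange_big [X in _ = _ + (_ - _ * X)]exchange_big /=.
  rewrite mulr_sumr -!sumrN -!big_split /=; apply: eq_bigr => i _.
  rewrite DM Dphi IH /phi_poly mulrBl mulrBr mulr_suml mulrCA.
  have -> : j - i - a + 1 = j - a + 1 - i by lia.
  congr (_ - _ + (_ - _)).
  - by apply: eq_bigr => s _; rewrite mulrA.
  - by rewrite mulrA.
  - rewrite mulrCA; congr (_ * _); rewrite mulr_sumr.
    by apply: eq_bigr => s _; rewrite mulrCA.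
rewrite dphi_convolution; last by rewrite /B; lia.
rewrite addrACA -big_split /=; congr (_ + _).
  rewrite -sum_phi; last by rewrite /B; lia.
  rewrite mulr_sumr; apply: eq_bigr => i _.
  by rewrite -!mulrA -mulrDl -intrD; congr (_%:~R * _); lia.
rewrite -opprD; congr (- _).
have -> : \sum_(s < N) c s * \sum_(i <- window B) V s i * V t (j - i) =
          \sum_(s < N) c s * V (t.+1 + s).-1 j.
  apply: eq_bigr => s _; rewrite VM; last by rewrite /B; lia.
    by rewrite addSn addnC.
  by have := ltn_ord s; rewrite /B; lia.
rewrite mulrSr mulrDl mul1r addrC; congr (_ + _).
(* At [t = 0] the predecessor may truncate, but the factor [t] vanishes. *)
case: t {IH} @B sum_phi => [|t] B sum_phi; first by rewrite !mul0r.
congr (_ * _); apply: eq_bigr => s _; rewrite sum_phi //.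
by have := ltn_ord s; rewrite /B; lia.
Qed.

(** Asking for every bound [n >= N] forces [c] to vanish from [N] on, so that two representations
    can share a bound. *)
Definition is_phi_poly (F : int -> A) :=
  exists c N, forall n j, (N <= n)%N -> F j = phi_poly n c j.

Lemma is_phi_polyD F G : is_phi_poly F -> is_phi_poly G -> is_phi_poly (fun j => F j + G j).
Proof.
move=> [c [N Fc]] [d [M Gd]]; exists (fun s => c s + d s), (maxn N M) => n j.
rewrite geq_max => /andP[Nn Mn]; rewrite (Fc n) // (Gd n) // -big_split.
by apply: eq_bigr => s _; rewrite mulrDl.
Qed.

Lemma is_phi_polyZ x F : is_phi_poly F -> is_phi_poly (fun j => x * F j).
Proof.
move=> [c [N Fc]]; exists (fun s => x * c s), N => n j Nn.
by rewrite (Fc n) // mulr_sumr; apply: eq_bigr => s _; rewrite mulrA.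
Qed.

Lemma is_phi_polyN F : is_phi_poly F -> is_phi_poly (fun j => - F j).
Proof.
move=> [c [N Fc]]; exists (fun s => - c s), N => n j Nn.
by rewrite (Fc n) // -sumrN; apply: eq_bigr => s _; rewrite mulNr.
Qed.

Lemma is_phi_poly_power t : is_phi_poly (V t).
Proof.
exists (fun s => (s == t)%:R), t.+1 => n j tn.
rewrite /phi_poly (bigD1 (Ordinal tn)) //= eqxx mul1r big1 ?addr0 // => s.
by rewrite -val_eqE /= => /negPf ->; rewrite mul0r.
Qed.

Lemma is_phi_poly_sum n (F : nat -> int -> A) :
  (forall s, is_phi_poly (F s)) -> is_phi_poly (fun j => \sum_(s < n) F s j).
Proof.
move=> FP; elim: n => [|n [c [N Fc]]].
  by exists (fun=> 0), 0%N => n j _; rewrite big_ord0 /phi_poly big1 // => s _; rewrite mul0r.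
have [d [M Fd]] := is_phi_polyD (ex_intro _ c (ex_intro _ N Fc)) (FP n).
by exists d, M => m j Mm; rewrite big_ord_recr /= (Fd m).
Qed.

Lemma is_phi_poly_phi_poly n c : is_phi_poly (phi_poly n c).
Proof.
by apply: (@is_phi_poly_sum n (fun s j => c s * V s j)) => s; exact/is_phi_polyZ/is_phi_poly_power.
Qed.

(** Among [phi^0, ..., phi^N] only [phi^N] reaches [lambda^(-N)], with coefficient 1; hence the
    leading coefficient vanishes, and one descends on [N]. *)
Lemma is_phi_poly_eq0 F : is_phi_poly F -> (forall j, j <= 0 -> F j = 0) -> forall j, F j = 0.
Proof.
move=> [c [N /(_ N)Fc]] F0.
have {}Fc j : F j = phi_poly N c j by apply: Fc.
elim: N Fc => [|N IH] Fc; first by move=> j; rewrite Fc /phi_poly big_ord0.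
apply: IH => j; rewrite Fc /phi_poly big_ord_recr /=.
suff -> : c N = 0 by rewrite mul0r addr0.
have := F0 (- N%:Z); rewrite Fc /phi_poly big_ord_recr /= V_top mulr1 big1 ?add0r.
  by apply; lia.
by move=> s _; rewrite V_small ?mulr0 //; have := ltn_ord s; lia.
Qed.

Lemma witt_bracket (Da Db : {additive A -> A}) a b Na Nb Nc ca cb cc :
  let fa j := lam_dphi a j - phi_poly Na ca j in
  let fb j := lam_dphi b j - phi_poly Nb cb j in
  let fc j := lam_dphi (a + b - 1) j - phi_poly Nc cc j in
  is_derivation Da -> is_derivation Db ->
  (forall j, Da (phi j) = fa j) -> (forall j, Db (phi j) = fb j) ->
  (forall j, j <= 0 -> fa j = 0) -> (forall j, j <= 0 -> fb j = 0) ->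
  (forall j, j <= 0 -> fc j = 0) ->
  forall j, Da (fb j) - Db (fa j) = (a - b)%:~R * fc j.
Proof.
move=> fa fb fc DaM DbM Daphi Dbphi fa0 fb0 fc0 j.
(* [Q] collects the action of [D] on the coefficients, [P] the terms [t phi^(t-1) p(phi)]; both are
   again polynomials in [phi]. *)
pose Q (D : A -> A) N (c : nat -> A) j := \sum_(t < N) D (c t) * V t j.
pose P N (c : nat -> A) M (d : nat -> A) j :=
  \sum_(t < N) (c t * t%:R) * \sum_(s < M) d s * V (t + s).-1 j.
have QP D N c : is_phi_poly (Q D N c) by exact: (is_phi_poly_phi_poly N (D \o c)).
have PP N c M d : is_phi_poly (P N c M d).
  apply: (@is_phi_poly_sum N (fun t j => (c t * t%:R) * \sum_(s < M) d s * V (t + s).-1 j)) => t.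
  apply/is_phi_polyZ/(@is_phi_poly_sum M (fun s j => d s * V (t + s).-1 j)) => s.
  exact/is_phi_polyZ/is_phi_poly_power.
(* The second and third terms on the right are the mixed ones; exchanging the two derivations
   exchanges them. *)
have expand (D : {additive A -> A}) e e' N M c d : is_derivation D ->
  (forall i, D (phi i) = lam_dphi e i - phi_poly N c i) ->
  forall i, D (lam_dphi e' i - phi_poly M d i) =
    (i - e' + 1)%:~R * lam_dphi e (i - e' + 1)
    - (i - e' + 1)%:~R * phi_poly N c (i - e' + 1)
    - (i - e + 1)%:~R * phi_poly M d (i - e + 1) - Q D M d i + P M d N c i.
  move=> DM Dphi i; rewrite raddfB derivation_int // Dphi mulrBr.
  set k := i - e + 1; set k' := i - e' + 1; rewrite -!addrA; congr (_ + (_ + _)).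
  rewrite raddf_sum mulr_sumr -!sumrN -!big_split /=; apply: eq_bigr => t _.
  rewrite DM (derivation_power DM Dphi) -/k.
  set X := \sum_(s < N) _; set y := V t k; set z := V t i; ring.
pose G j := Da (fb j) - Db (fa j) - (a - b)%:~R * fc j.
suff : forall j, G j = 0 by move/(_ j)/eqP; rewrite subr_eq0 => /eqP.
apply: is_phi_poly_eq0; last first.
  by move=> i i0; rewrite /G fa0 // fb0 // fc0 // (raddf0 Da) (raddf0 Db) mulr0 !subr0.
have [c [N GE]] : is_phi_poly (fun i => P Nb cb Na ca i - Q Da Nb cb i
   - (P Na ca Nb cb i - Q Db Na ca i) + (a - b)%:~R * phi_poly Nc cc i).
  apply: is_phi_polyD; last exact/is_phi_polyZ/is_phi_poly_phi_poly.
  apply: is_phi_polyD; first by apply: is_phi_polyD => //; apply: is_phi_polyN.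
  apply: is_phi_polyN.
  by apply: is_phi_polyD => //; apply: is_phi_polyN.
exists c, N => n i Nn; rewrite -GE // /G /fa /fb /fc (expand _ _ _ _ _ _ _ DaM Daphi) (expand _ _ _ _ _ _ _ DbM Dbphi).
rewrite /lam_dphi.
(* The terms without [p_a], [p_b] meet at the same coefficient, with weights [i - b + 1] and
   [i - a + 1]; their difference gives the factor [a - b]. *)
have -> : i - b + 1 - a + 1 = i - (a + b - 1) + 1 by lia.
have -> : i - a + 1 - b + 1 = i - (a + b - 1) + 1 by lia.
have -> : a - b = (i - b + 1) - (i - a + 1) by lia.
rewrite intrB; ring.
Qed.

End LaurentPowers.

(** * Triangular systems and powers of power series *)

Lemma strong_recursion (T : Type) (x : T) (H : nat -> (nat -> T) -> T) :
  (forall s d d', (forall r, (r < s)%N -> d r = d' r) -> H s d = H s d') ->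
  exists d, forall s, d s = H s d.
Proof.
(* The iterate [D n] is already final below [n], so the diagonal solves the recursion. *)
move=> Hloc; pose D n := iter n (fun d s => H s d) (fun=> x).
have stable s : forall n m, (s < n)%N -> (s < m)%N -> D n s = D m s.
  elim/ltn_ind: s => s IH [|n] [|m] // sn sm.
  by apply: Hloc => r rs; apply: IH => //; apply: leq_trans rs _.
exists (fun s => D s.+1 s) => s; apply: Hloc => r rs.
exact: stable.
Qed.

Lemma triangular_solution (A : nzRingType) (F : nat -> A) (G : nat -> nat -> A) :
  exists d : nat -> A, forall s, F s = \sum_(r < s) d r * G s r + d s.
Proof.
have [|d dE] := @strong_recursion A 0 (fun s d => F s - \sum_(r < s) d r * G s r).
  by move=> s d d' dd'; congr (_ - _); apply: eq_bigr => r _; rewrite dd'.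
by exists d => s; rewrite [d s]dE addrC subrK.
Qed.

Section PowerSeries.
Implicit Types (a b : nat -> RP) (N n k : nat).

Lemma pspowS a k n : pspow a k.+1 n = \sum_(i < n.+1) a i * pspow a k (n - i).
Proof. by []. Qed.

(** Truncation to a polynomial imports the laws of powers from the polynomial ring. *)
Lemma pspow_coef N a k n : (n < N)%N -> pspow a k n = ((\poly_(i < N) a i) ^+ k)`_n.
Proof.
elim: k n => [|k IH] n nN; first by rewrite expr0 coef1.
rewrite pspowS exprS coefM; apply: eq_bigr => i _.
have iN : (i < N)%N by apply: leq_trans nN; exact: ltn_ord.
by rewrite coef_poly iN IH //; apply: leq_ltn_trans (leq_subr _ _) nN.
Qed.

Lemma pspowD a s t n :
  pspow a (s + t) n = \sum_(i < n.+1) pspow a s i * pspow a t (n - i).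
Proof.
rewrite (@pspow_coef n.+1) // exprD coefM; apply: eq_bigr => i _.
by rewrite !(@pspow_coef n.+1) // ltnS leq_subr.
Qed.

Lemma pspow_const1 a k : a 0%N = 1 -> pspow a k 0%N = 1.
Proof. by move=> a0; elim: k => //= k IH; rewrite /psmul big_ord1 a0 IH mulr1. Qed.

Lemma upow_const1 (k : int) : upow k 0%N = 1.
Proof. by case: k => k; apply: pspow_const1 => //; rewrite /psinv big_ord1. Qed.

End PowerSeries.

(** * The Laurent series [phi^k] and expansions in them *)

Lemma phipow_small (k j : int) : j < - k -> phipow k j = 0.
Proof. by move=> jk; rewrite /phipow; case E : (j + k) => [n|] //; lia. Qed.

Lemma phipow_top (k : int) : phipow k (- k) = 1.
Proof. by rewrite /phipow addNr; exact: upow_const1. Qed.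

Lemma phipow0 (j : int) : phipow 0%N j = (j == 0)%:R.
Proof. by rewrite /phipow addr0; case: j => [[|n]|n]. Qed.

Lemma phipow1 (j : int) : phipow 1%N j = phic j.
Proof.
rewrite /phipow; case E : (j + 1%N) => [n|n] /=; last first.
  by have -> : j = Negz n.+1 by lia.
rewrite /psmul big_ord_recr /= subnn mulr1 big1 ?add0r; last first.
  by move=> i _; rewrite /ps1 subn_eq0 leqNgt ltn_ord mulr0.
by rewrite /useries; congr phic; lia.
Qed.

(** As [phi^s = lambda^(-s) u^s], shifting the index by [s] turns the window sum into the
    convolution of [pspowD]. *)
Lemma phipowM s t (j : int) B : (s <= B)%N -> j + t%:Z <= B%:Z ->
  \sum_(i <- window B) phipow s i * phipow t (j - i) = phipow (s + t)%N j.
Proof.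
move=> sB tB; have [neg|pos] := ltP (j + s%:Z + t%:Z) 0.
  rewrite phipow_small; last by lia.
  rewrite big1 // => i _; have [i1|i1] := ltP i (- s%:Z).
    by rewrite phipow_small // mul0r.
  by rewrite [phipow t _]phipow_small ?mulr0 //; lia.
pose n := absz (j + s%:Z + t%:Z).
have -> : phipow (s + t)%N j = pspow useries (s + t) n.
  by rewrite /phipow (_ : j + (s + t)%N = n%:Z) //; lia.
rewrite pspowD.
rewrite (@big_seq_support _ _ _ [seq i%:Z - s%:Z | i <- iota 0 n.+1]).
- rewrite [LHS]big_map -[iota 0 _]/(index_iota 0 n.+1) big_mkord; apply: eq_bigr => i _.
  have := ltn_ord i; rewrite ltnS => i_n.
  rewrite /phipow subrK; congr (_ * _).
  by rewrite (_ : j - (i%:Z - s%:Z) + t = (n - i)%N%:Z) //; lia.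
- exact: window_uniq.
- by rewrite map_inj_uniq ?iota_uniq // => x y; lia.
move=> i hi; have [i1 i2] : - s%:Z <= i /\ i <= j + t%:Z.
  split; rewrite leNgt; apply: contraNN hi => hi; apply/eqP.
    by rewrite phipow_small ?mul0r.
  by rewrite [phipow t _]phipow_small ?mulr0 //; lia.
rewrite mem_window; apply/andP; split; first by lia.
by apply/mapP; exists (absz (i + s%:Z)); [rewrite mem_iota|]; lia.
Qed.

(* The coefficient of [phi^k] is determined by the coefficient of [lambda^(-k)] and the
   coefficients of the higher powers of [phi], as [phi^k = lambda^(-k) (1 + ...)]. *)
Lemma phi_expansion_exists (F : int -> RP) (m : int) :
  (forall j, j < - m -> F j = 0) -> exists c, phi_expansion F m c.
Proof.
move=> F0; pose G s r := phipow (m - r%:Z) (s%:Z - m).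
have [d dE] := triangular_solution (fun s => F (s%:Z - m)) G.
(* [d] is indexed by the distance below the top exponent [m]; the expansion reads only [k <= m]. *)
exists (fun k => d (absz (m - k))) => j.
have [neg|pos] := ltP (m + j) 0.
  rewrite F0; last by lia.
  rewrite (_ : nat_of_int _ = 0%N) ?big_ord0 //.
  by case E : (m + j + 1) => [[|n]|n] //; lia.
pose s := absz (m + j).
rewrite (_ : nat_of_int _ = s.+1); last by rewrite (_ : m + j + 1 = s.+1%:Z) //; lia.
rewrite (reindex_inj rev_ord_inj) /=.
transitivity (\sum_(r < s.+1) d r * G s r); last first.
  apply: eq_bigr => r _; have := ltn_ord r; rewrite ltnS => rs.
  by congr (d _ * phipow _ _); lia.
rewrite big_ord_recr /= {2}/G (_ : s%:Z - m = - (m - s%:Z)); last by lia.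
rewrite phipow_top mulr1 -dE; congr F; lia.
Qed.

Lemma fser_phi_poly (n : int) : exists N c,
  (forall j, fser n j = lam_dphi phic n j - phi_poly (fun t => phipow t) N c j) /\
  (forall j, j <= 0 -> fser n j = 0).
Proof.
(* [lambda^n phi_lambda] starts at [lambda^(n-2)], so [2 - n] is a possible top exponent, and
   [epsilon] picks a genuine expansion. *)
have [c0 c0E] : exists c, phi_expansion (lamphi n) (2 - n) c.
  apply: phi_expansion_exists => j jn; rewrite /lamphi.
  have [m ->] : exists m, j - n + 1 = Negz m.+1 by exists (absz (j - n + 3)); lia.
  by rewrite mulr0.
have := epsilon_spec (inhabits ((0 : int), fun _ => (0 : RP)))
  (fun p => phi_expansion (lamphi n) p.1 p.2) (ex_intro _ ((2 - n), c0) c0E).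
rewrite -/(phi_exp _); set m := (phi_exp _).1; set c := (phi_exp _).2 => cE.
exists (nat_of_int (m + 1)), (fun t => c t%:Z); split=> // j j0.
rewrite /fser /fPphi /Pphi -/m -/c cE.
pose q := absz j; have jq : j = - q%:Z by lia.
(* If [m < q], no power up to [phi^m] reaches [lambda^(-q)]. Otherwise the powers below [phi^q]
   vanish there, and the remaining terms of [Pphi] are exactly those of the expansion. *)
have [mq|mq] := ltP m q%:Z.
  rewrite (_ : nat_of_int (m + j + 1) = 0%N); last by case E : (m + j + 1) => [[|k]|k] //; lia.
  rewrite big_ord0 big1 ?subr0 // => t _; rewrite phipow_small ?mulr0 //.
  have : t%:Z < m + 1 by case: (m + 1) t => [k|k] [t ?].
  lia.
pose k := absz (m + j + 1).
rewrite (_ : nat_of_int (m + j + 1) = k); last by rewrite (_ : m + j + 1 = k%:Z) //; lia.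
rewrite (_ : nat_of_int (m + 1) = (q + k)%N); last by rewrite (_ : m + 1 = (q + k)%N%:Z) //; lia.
rewrite big_split_ord /= [X in _ - (X + _)]big1 ?add0r.
  apply/eqP; rewrite subr_eq0; apply/eqP; apply: eq_bigr => t _.
  by congr (c _ * phipow _ _); rewrite jq; lia.
by move=> t _; rewrite phipow_small ?mulr0 //; have := ltn_ord t; lia.
Qed.

(** * The commutator relation as the vanishing of a derivation *)

Section Commutator.
Variables (A : comNzRingType) (D1 D2 D3 : {additive A -> A}) (z : int).
Hypotheses (D1M : is_derivation D1) (D2M : is_derivation D2) (D3M : is_derivation D3).

Definition commutator_defect x := D1 (D2 x) - D2 (D1 x) - z%:~R * D3 x.

Lemma commutator_defectB : zmod_morphism commutator_defect.
Proof. by move=> x y; rewrite /commutator_defect !(raddfB D1, raddfB D2, raddfB D3); ring. Qed.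

HB.instance Definition _ := GRing.isZmodMorphism.Build A A commutator_defect commutator_defectB.

(** The cross products [D1 x * D2 y] and [D2 x * D1 y] arise in both orders of composition and
    cancel. *)
Lemma commutator_defectM : is_derivation commutator_defect.
Proof.
move=> x y; rewrite /commutator_defect D1M D2M D3M (raddfD D1) (raddfD D2) !D1M !D2M; ring.
Qed.

Lemma commutator_defect_const x : D1 x = 0 -> D2 x = 0 -> D3 x = 0 -> commutator_defect x = 0.
Proof.
by rewrite /commutator_defect => -> -> ->; rewrite (raddf0 D1) (raddf0 D2) mulr0 !subr0.
Qed.

Lemma commutator_defect_eq0 x :
  commutator_defect x = 0 <-> D1 (D2 x) - D2 (D1 x) = z%:~R * D3 x.
Proof.
split=> [/eqP|E]; first by rewrite subr_eq0 => /eqP.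
by rewrite /commutator_defect E subrr.
Qed.

End Commutator.

(** * The derivations [der f] and the Witt relations *)

Lemma der_zmod_morphism f : zmod_morphism (der f).
(* [der f] unfolds to [malgder]; the shift [i.+1] appears because index [i] stands for
   [phi^(i+1)]. *)
Proof. exact: (malgderB (monder (fun i : nat => f i.+1))). Qed.

HB.instance Definition _ f := GRing.isZmodMorphism.Build RP RP (der f) (der_zmod_morphism f).

Lemma derM f : is_derivation (der f).
Proof. exact: (malgderM (monderM (fun i : nat => f i.+1))). Qed.

Lemma derC f c : der f c%:MP = 0.
Proof.
exact: (etrans (malgder_monom _ c mone) (etrans (congr1 _ (monder1 _)) (scaler0 _ c))).
Qed.

Lemma der_var f i : der f << ucm i >> = f i.+1.
Proof.
exact: (etrans (malgder_monom _ 1 (ucm i)) (etrans (scale1r _) (monder_var _ i))).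
Qed.

(** For [j <= 0] the coefficient [phic j] is the constant 0 or 1, which [der f] kills; hence the
    condition on [f]. *)
Lemma der_phic f : (forall j, j <= 0 -> f j = 0) -> forall j, der f (phic j) = f j.
Proof.
move=> f0 [[|i]|[|i]]; last by rewrite f0 //; exact: (raddf0 (der f)).
- by rewrite f0 //; exact: (raddf0 (der f)).
- exact: der_var.
- by rewrite f0 //; exact: (derC f 1).
Qed.

Lemma fser_bracket (a b j : int) :
  der (fser a) (fser b j) - der (fser b) (fser a j) = (a - b)%:~R * fser (a + b - 1) j.
Proof.
have [Na [ca [aE a0]]] := fser_phi_poly a.
have [Nb [cb [bE b0]]] := fser_phi_poly b.
have [Nc [cc [cE c0]]] := fser_phi_poly (a + b - 1).
rewrite bE aE cE.
apply: (@witt_bracket RP phic (fun t => phipow t) phipow0 phipow1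
  (fun t => @phipow_small t) (fun t => phipow_top t) phipowM
  (der (fser a)) (der (fser b)) a b Na Nb Nc ca cb cc (derM _) (derM _)).
- by move=> i; exact: (etrans (der_phic a0 i) (aE i)).
- by move=> i; exact: (etrans (der_phic b0 i) (bE i)).
- by move=> i i0; exact: (etrans (esym (aE i)) (a0 i i0)).
- by move=> i i0; exact: (etrans (esym (bE i)) (b0 i i0)).
- by move=> i i0; exact: (etrans (esym (cE i)) (c0 i i0)).
Qed.

(** Tying [c] and [z] by equations lets the indices [1 - (n + m)] and [m - n] be matched by integer
    arithmetic. *)
Lemma fser_bracket_var (a b c z : int) i : c = a + b - 1 -> z = a - b ->
  der (fser a) (der (fser b) << ucm i >>) - der (fser b) (der (fser a) << ucm i >>)
  = z%:~R * der (fser c) << ucm i >>.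
Proof.
move=> -> ->.
have derV f g : der f (der g << ucm i >>) = der f (g i.+1) := congr1 (der f) (der_var g i).
apply: etrans (f_equal2 (fun x y : RP => x - y) (derV _ _) (derV _ _)) _.
exact: etrans (fser_bracket a b i.+1) (congr1 (fun x : RP => _ * x) (esym (der_var _ i))).
Qed.

Theorem mainTheorem1 :
  forall (n m : int) (p : RP),
    S n (S m p) - S m (S n p) = (m - n)%:~R * S (n + m) p.
Proof.
move=> n m p; apply/commutator_defect_eq0.
apply: (derivation_generators_eq0 (D := commutator_defect _ _ _ _) (@cmonom_gen_ind nat)).
- exact: commutator_defectM (derM _) (derM _) (derM _).
- by move=> c; apply: commutator_defect_const; exact: derC.
- by move=> i; apply/commutator_defect_eq0; apply: fser_bracket_var; lia.
Qed.
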